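(* Let $R$ be a finite chain ring and $n\ge 1$. For any basis $B=\{\mathsf b_1,\dots,\mathsf b_n\}$ of the free module $R^n$ and any multiplicative selection property $P$ on $R^n$, the lexicode $C(B,P)$ produced by Algorithm A is linear (i.e. an $R$-submodule of $R^n$), and $P[\mathsf x]$ holds for each codeword $\mathsf x\in C(B,P)$ with $\mathsf x\neq 0$.
   Context: A finite chain ring $R$ is a finite commutative local principal ideal ring with identity, with maximal ideal $\langle\gamma\rangle$, where $\gamma$ is nilpotent of nilpotency index $e$ (so the ideals are $\langle 0\rangle=\langle\gamma^e\rangle\subsetneq\langle\gamma^{e-1}\rangle\subsetneq\dots\subsetneq\langle\gamma\rangle\subsetneq R$). $R^*=R\setminus\langle\gamma\rangle$ is the set of units. Fix an enumeration $R=\{\alpha_1,\dots,\alpha_m\}$, $m=|R|$. B-ordering: for a basis $B=\{\mathsf b_1,\dots,\mathsf b_n\}$ of $R^n$, define ordered lists recursively by $V_0:=0$ and, for $1\le i\le n$, $V_i$ is the list $V_{i-1}$ followed by the blocks $\alpha\mathsf b_i+V_{i-1}$, where $\alpha$ runs through the nonzero elements of $R$ in the order of the enumeration, each block being ordered as $V_{i-1}$ is. Thus $|V_i|=m^i$, and as a set $V_i$ is the span of $\mathsf b_1,\dots,\mathsf b_i$, with $V_n=R^n$. A selection property is a boolean-valued function $P:R^n\to\{\text{True},\text{False}\}$; writing $P[\mathsf x]$ means that $P[\mathsf x]$ is true. It is multiplicative if $P[\mathsf x]$ implies $P[\beta\mathsf x]$ for all $\beta\in R^*$. Algorithm A: put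 $C_0:=\{0\}$. For $i=1,\dots,n$: select the first vector $\mathsf a_i\in V_i\setminus V_{i-1}$ (in the order of the list $V_i$) such that $P[\gamma^j\mathsf a_i+\mathsf c]$ for all $0\le j\le e-1$ and all $\mathsf c\in C_{i-1}$. If such an $\mathsf a_i$ exists, put $C_i:=\bigcup_{\alpha\in R}(\alpha\mathsf a_i+C_{i-1})$; otherwise put $C_i:=C_{i-1}$. The lexicode is $C(B,P):=C_n$. *)

(* Defs.v *)
From HB Require Import structures.
From mathcomp Require Import all_boot all_order all_algebra.

Set Implicit Arguments.
Unset Strict Implicit.
Unset Printing Implicit Defensive.

Import GRing.Theory.
Local Open Scope ring_scope.

(* Scaling in R^o is multiplication in R, so submodules of R^o are ideals.      *)
Definition is_ideal (R : finComUnitRingType) (I : {set R}) : Prop :=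
  submod_closed (I : {pred R^o}).

Definition principal_ideal (R : finComUnitRingType) (a : R) : {set R} :=
  [set r * a | r : R].

Definition maximal_ideal (R : finComUnitRingType) (M : {set R}) : Prop :=
  [/\ is_ideal M, M != [set: R]
    & forall I : {set R}, is_ideal I -> M \subset I -> I = M \/ I = [set: R]].

Definition local_ring (R : finComUnitRingType) : Prop :=
  exists! M : {set R}, maximal_ideal M.

Definition principal_ideal_ring (R : finComUnitRingType) : Prop :=
  forall I : {set R}, is_ideal I -> exists a : R, I = principal_ideal a.

Definition chain_ring (R : finComUnitRingType) : Prop :=
  local_ring R /\ principal_ideal_ring R.

Definition nilpotency_index (R : finComUnitRingType) (a : R) (e : nat) : Prop :=
  a ^+ e = 0 /\ (forall k : nat, (k < e)%N -> a ^+ k != 0).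

Definition enumeration (R : finComUnitRingType) (alpha : seq R) : Prop :=
  uniq alpha /\ (forall a : R, a \in alpha).

Definition is_basis (R : finComUnitRingType) (n : nat)
    (b : n.-tuple 'rV[R]_n) : Prop :=
  (forall c : 'I_n -> R,
     \sum_(i < n) c i *: tnth b i = 0 -> forall i, c i = 0) /\
  (forall v : 'rV[R]_n, exists c : 'I_n -> R,
     v = \sum_(i < n) c i *: tnth b i).

(* b_i (1 <= i <= n) is the tuple entry b`_i.-1; the comprehension is           *)
(* row-major: a selects the block and v runs through V_(i-1) inside it.         *)
Fixpoint Vlist (R : finComUnitRingType) (n : nat) (alpha : seq R)
    (b : n.-tuple 'rV[R]_n) (i : nat) : seq 'rV[R]_n :=
  if i is i'.+1 then
    Vlist alpha b i' ++
      [seq a *: b`_i' + v | a <- [seq a <- alpha | a != 0], v <- Vlist alpha b i']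
  else [:: 0].

Definition multiplicative_selection (R : finComUnitRingType) (n : nat)
    (P : 'rV[R]_n -> bool) : Prop :=
  forall (x : 'rV[R]_n) (beta : R),
    beta \is a GRing.unit -> P x -> P (beta *: x).

Definition selectable (R : finComUnitRingType) (n : nat) (gamma : R) (e : nat)
    (P : 'rV[R]_n -> bool) (C : {set 'rV[R]_n}) (a : 'rV[R]_n) : bool :=
  [forall j : 'I_e, [forall c in C, P (gamma ^+ j *: a + c)]].

(* The candidate a_i at step i >= 1, where C is C_(i-1).                        *)
Definition select (R : finComUnitRingType) (n : nat) (gamma : R) (e : nat)
    (alpha : seq R) (b : n.-tuple 'rV[R]_n) (P : 'rV[R]_n -> bool)
    (i : nat) (C : {set 'rV[R]_n}) : option 'rV[R]_n :=
  ohead [seq a <- Vlist alpha b i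
        | (a \notin Vlist alpha b i.-1) && selectable gamma e P C a].

Fixpoint algA (R : finComUnitRingType) (n : nat) (gamma : R) (e : nat)
    (alpha : seq R) (b : n.-tuple 'rV[R]_n) (P : 'rV[R]_n -> bool)
    (i : nat) : {set 'rV[R]_n} :=
  if i is i'.+1 then
    let C := algA gamma e alpha b P i' in
    if select gamma e alpha b P i'.+1 C is Some a then
      \bigcup_(r : R) [set r *: a + c | c in C]
    else C
  else [set 0].

Definition lexicode (R : finComUnitRingType) (n : nat) (gamma : R) (e : nat)
    (alpha : seq R) (b : n.-tuple 'rV[R]_n) (P : 'rV[R]_n -> bool) :
    {set 'rV[R]_n} :=
  algA gamma e alpha b P n.

(* Main.v *)
Require Import Defs.
From HB Require Import structures.
From mathcomp Require Import all_boot all_order all_algebra.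

Set Implicit Arguments.
Unset Strict Implicit.
Unset Printing Implicit Defensive.

Import GRing.Theory.
Local Open Scope ring_scope.

(** Every nonzero [r] in [R] is [u * gamma ^+ j] with [u] a unit and [j < e].
    A new codeword [r *: a_i + c] with [c] in [C_(i-1)] and [r != 0] is thus
    [u *: (gamma ^+ j *: a_i + u^-1 *: c)]; as [C_(i-1)] is a submodule, it
    contains [u^-1 *: c], so the selection of [a_i] and multiplicativity of [P]
    apply. *)

Lemma unit_1_sub_nilp (R : comUnitRingType) (x : R) (e : nat) :
  x ^+ e = 0 -> 1 - x \is a GRing.unit.
Proof.
move=> xe0; have := subrXX 1 x e.
(* The geometric sum, cofactor of [1 - x] in [1 - x ^+ e = 1], is the inverse. *)
rewrite expr1n xe0 subr0 => /esym h1; apply/unitrPr; eexists; exact: h1.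
Qed.

Lemma principal_idealP (R : finComUnitRingType) (a x : R) :
  reflect (exists s, x = s * a) (x \in principal_ideal a).
Proof.
by apply: (iffP imsetP) => [[s _ ->]|[s ->]]; exists s.
Qed.

Section MaximalNilpotent.

Variables (R : finComUnitRingType) (gamma : R) (e : nat).
Hypothesis gamma_max : maximal_ideal (principal_ideal gamma).
Hypothesis gamma_nilp : gamma ^+ e = 0.

(** The ideal [I] generated by [gamma] and [r] properly contains the maximal ideal, so it contains
    1. Writing [1 = s * gamma + t * r] makes [t * r] equal to 1 minus a nilpotent element, hence a
    unit. *)
Lemma unit_notin_max_nilp (r : R) :
  r \notin principal_ideal gamma -> r \is a GRing.unit.
Proof.
move=> rM; have [_ _ maxM] := gamma_max.
pose I := [set s.1 * gamma + s.2 * r | s : R * R].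
have idI : is_ideal I.
  split=> [|a _ _ /imsetP[s _ ->] /imsetP[t _ ->]].
    by apply/imsetP; exists (0, 0); rewrite // !mul0r addr0.
  apply/imsetP; exists (a * s.1 + t.1, a * s.2 + t.2) => //=.
  by rewrite /GRing.scale /= !mulrDl mulrDr !mulrA addrACA.
have MI : principal_ideal gamma \subset I.
  apply/subsetP => _ /principal_idealP[s ->].
  by apply/imsetP; exists (s, 0); rewrite //= mul0r addr0.
have rI : r \in I by apply/imsetP; exists (0, 1); rewrite //= mul0r mul1r add0r.
have [IM|IT] := maxM I idI MI; first by rewrite -IM rI in rM.
have /imsetP[[s t] _ /= st1] : 1 \in I by rewrite IT inE.
have : 1 - s * gamma \is a GRing.unit.
  by apply: (@unit_1_sub_nilp _ _ e); rewrite exprMn gamma_nilp mulr0.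
(* Only the first 1 is expanded, which turns [1 - s * gamma] into [t * r]; a factor of a unit is a
   unit. *)
by rewrite {1}st1 addrC addKr unitrM => /andP[].
Qed.

(** Factors [gamma] are split off [r] until the cofactor leaves the maximal ideal and is therefore a
    unit. This stops before [e] factors, since [gamma ^+ e = 0] would force [r = 0]. The exponent
    lives in ['I_e], the range over which [selectable] quantifies. *)
Lemma unit_mul_expr_max_nilp (r : R) : r != 0 ->
  exists u (j : 'I_e), u \is a GRing.unit /\ r = u * gamma ^+ j.
Proof.
move=> r_neq0.
have : forall k, (exists s, r = s * gamma ^+ k) \/
    exists u j, [/\ (j < k)%N, u \is a GRing.unit & r = u * gamma ^+ j].
  elim=> [|k [[s rs]|[u [j [jk uU ru]]]]].
  - by left; exists r; rewrite expr0 mulr1.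
  - have [/principal_idealP[t st]|sM] := boolP (s \in principal_ideal gamma).
      by left; exists t; rewrite rs st exprS mulrA.
    by right; exists s, k; split=> //; exact: unit_notin_max_nilp.
  - by right; exists u, j; split=> //; exact: ltnW.
case/(_ e) => [[s rs]|[u [j [je uU ru]]]].
  by rewrite rs gamma_nilp mulr0 eqxx in r_neq0.
by exists u, (Ordinal je).
Qed.

End MaximalNilpotent.

Lemma bigcup_translatesP (R : finComUnitRingType) (n : nat)
    (C : {set 'rV[R]_n}) (a x : 'rV[R]_n) :
  reflect (exists r c, c \in C /\ x = r *: a + c)
    (x \in \bigcup_(r : R) [set r *: a + c | c in C]).
Proof.
apply: (iffP bigcupP) => [[r _ /imsetP[c cC ->]]|[r [c [cC ->]]]].
  by exists r, c.
by exists r => //; exact: imset_f.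
Qed.

Lemma submod_closed_bigcup_translates (R : finComUnitRingType) (n : nat)
    (C : {set 'rV[R]_n}) (a : 'rV[R]_n) :
  submod_closed C ->
  submod_closed (\bigcup_(r : R) [set r *: a + c | c in C]).
Proof.
move=> [C0 CD]; split=> [|k x y].
  by apply/bigcup_translatesP; exists 0, 0; rewrite scale0r addr0.
move=> /bigcup_translatesP[r [c [cC ->]]] /bigcup_translatesP[s [d [dC ->]]].
apply/bigcup_translatesP; exists (k * r + s), (k *: c + d); split; first exact: CD.
by rewrite scalerDr scalerA scalerDl addrACA.
Qed.

Lemma select_selectable (R : finComUnitRingType) (n : nat) (gamma : R) (e : nat)
    (alpha : seq R) (b : n.-tuple 'rV[R]_n) (P : 'rV[R]_n -> bool) (i : nat)
    (C : {set 'rV[R]_n}) (a : 'rV[R]_n) :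
  select gamma e alpha b P i C = Some a -> selectable gamma e P C a.
Proof.
rewrite /select; set s := filter _ _ => sa.
have : a \in s by case: s sa => //= y s [->]; exact: mem_head.
by rewrite mem_filter => /andP[/andP[]].
Qed.

Theorem theorem4 (R : finComUnitRingType) (hR : chain_ring R)
    (gamma : R) (hgamma : maximal_ideal (principal_ideal gamma))
    (e : nat) (he : nilpotency_index gamma e)
    (alpha : seq R) (halpha : enumeration alpha)
    (n : nat) (hn : (1 <= n)%N)
    (b : n.-tuple 'rV[R]_n) (hb : is_basis b)
    (P : 'rV[R]_n -> bool) (hP : multiplicative_selection P) :
  submod_closed (lexicode gamma e alpha b P) /\
  (forall x : 'rV[R]_n, x \in lexicode gamma e alpha b P -> x != 0 -> P x).
Proof.
have [ge0 _] := he.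
(* The claim is generalized from [n] to every step [i]. Both halves go through one induction,
   because the argument for [P] uses linearity of the previous code. *)
suff algAP i : submod_closed (algA gamma e alpha b P i) /\
  (forall x, x \in algA gamma e alpha b P i -> x != 0 -> P x) by exact: algAP.
elim: i => [|i [linC PC]] /=.
  split=> [|x]; last by rewrite inE => ->.
  split=> [|k u v]; rewrite !inE // => /eqP-> /eqP->.
  by rewrite scaler0 addr0.
case sel: select => [a|]; last by [].
split=> [|_ /bigcup_translatesP[r [c [cC ->]]] x_neq0].
  exact: submod_closed_bigcup_translates.
(* For [r = 0] the codeword is [c] itself, already in the previous code. *)
have [r0|r_neq0] := eqVneq r 0.
  by move: x_neq0; rewrite r0 scale0r add0r; exact: PC.
have [u [j [uU ->]]] := unit_mul_expr_max_nilp hgamma ge0 r_neq0.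
have -> : (u * gamma ^+ j) *: a + c = u *: (gamma ^+ j *: a + u^-1 *: c).
  by rewrite scalerDr !scalerA divrr // scale1r.
apply: hP => //; have /forallP/(_ j)/forall_inP := select_selectable sel.
(* Closure under [k *: x + y], taken at [y = 0], puts [u^-1 *: c] in the previous code. *)
by apply; have [C0 /(_ u^-1 c 0 cC C0)] := linC; rewrite addr0.
Qed.
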